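(* Let $m \ge 3$ be an integer and let $S=[s_0,s_1,\ldots,s_{m-1}]$ be a sequence with $s_i\in\{0,1\}$ for all $i$, $s_0=0$, $s_{m-1}=1$, and such that for each $i$ with $0\le i\le m-2$ at least one of $s_i,s_{i+1}$ is equal to $1$. Then the quasi wreath graph $QW(S)$ is distance magic if and only if each of its segments has length congruent to $1$ or $3$ modulo $4$ and the number of its segments whose length is congruent to $1$ modulo $4$ is even (the number of segments of length congruent to $3$ modulo $4$ being arbitrary).
   Context: For $S=[s_0,\ldots,s_{m-1}]$ as in the claim, the quasi wreath graph $QW(S)$ is the tetravalent (simple, undirected) graph of order $2m$ with vertex set $\{x_i : i\in\mathbb{Z}_m\}\cup\{y_i : i\in\mathbb{Z}_m\}$ and the following edges, with all subscripts computed modulo $m$: (i) for each $i\in\mathbb{Z}_m$, the edges $\{x_i,x_{i+1}\}$ and $\{y_i,y_{i+1}\}$; (ii) for each $i\in\mathbb{Z}_m$ with $s_i=0$, the edges $\{x_i,y_i\}$ and $\{x_{i+1},y_{i+1}\}$; (iii) for each $i\in\mathbb{Z}_m$ with $s_i=1$, the edges $\{x_i,y_{i+1}\}$ and $\{x_{i+1},y_i\}$. Blocks and segments: for $i\in\mathbb{Z}_m$ let $B_i=\{x_i,y_i\}$ (a block). For each $i\in\mathbb{Z}_m$ with $s_i=0$, let $j\ge 1$ be the smallest integer such that $s_{i+j}=0$ (index modulo $m$); the subgraph of $QW(S)$ induced on $B_{i+1}\cup B_{i+2}\cup\cdots\cup B_{i+j}$ is called a segment, and its length is $j$. Thus the segments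 correspond bijectively to the indices $i\in\mathbb{Z}_m$ with $s_i=0$. Distance magic: a distance magic labeling of a tetravalent graph $\Gamma=(V,E)$ of order $n$ is a bijection $\ell: V\to\{1-n,3-n,5-n,\ldots,n-3,n-1\}$ such that for each vertex $v$ the weight of $v$, i.e. the sum $\sum_{u\in N(v)}\ell(u)$ of the labels of the neighbors of $v$, equals $0$. (Equivalently, up to an affine relabeling, a bijection $V\to\{1,\ldots,n\}$ for which all vertices have the same sum of labels over their neighbors.) A graph is distance magic if it admits a distance magic labeling. *)

(* Defs.v *)
From mathcomp Require Import all_boot all_order all_algebra.

Set Implicit Arguments.
Unset Strict Implicit.
Unset Printing Implicit Defensive.

(* The list 1-n, 3-n, ..., n-1. *)
Definition dm_labels (n : nat) : seq int :=
  [seq ((2 * k + 1)%N%:Z - n%:Z)%R | k <- iota 0 n].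

(* A simple graph is given by its adjacency relation on a finite type. *)
Definition weight (V : finType) (adj : rel V) (l : V -> int) (v : V) : int :=
  (\sum_(u | adj v u) l u)%R.

Definition distance_magic_labeling
    (V : finType) (adj : rel V) (l : V -> int) : Prop :=
  [/\ injective l,
      codom l =i dm_labels #|V|
    & forall v, weight adj l v = 0%R].

Definition distance_magic (V : finType) (adj : rel V) : Prop :=
  exists l : V -> int, distance_magic_labeling adj l.

Section QuasiWreath.

Variables (m : nat) (S : m.-tuple bool).

(* The sequence S has s_i = 1 when [tnth S i = true] and s_i = 0 otherwise.
   Indices in 'I_m are cyclic: [ordS i] is i + 1 modulo m. *)

Definition qw_vertex : finType := ('I_m + 'I_m)%type.

Definition qx (i : 'I_m) : qw_vertex := inl i.
Definition qy (i : 'I_m) : qw_vertex := inr i.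

Definition qw_edges : {set {set qw_vertex}} :=
  \bigcup_(i : 'I_m)
    ([set [set qx i; qx (ordS i)]; [set qy i; qy (ordS i)]] :|:
     if tnth S i
     then [set [set qx i; qy (ordS i)]; [set qx (ordS i); qy i]]
     else [set [set qx i; qy i]; [set qx (ordS i); qy (ordS i)]]).

Definition QW : rel qw_vertex := [rel u v | [set u; v] \in qw_edges].

(* A segment is represented by the index i with s_i = 0 that it comes from
   (it consists of the blocks B_(i+1), ..., B_(i+j), where j is its length). *)
Definition segments : {set 'I_m} := [set i | ~~ tnth S i].

(* Searching j - 1 in 0, ..., m - 1 suffices: if s_i = 0 then j = m is
   admissible. *)
Definition segment_length (i : 'I_m) : nat :=
  (find (fun k => ~~ tnth S (iter k.+1 (@ordS m) i)) (iota 0 m)).+1.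

Lemma val_iter_ordS k (i : 'I_m) : iter k (@ordS m) i = (i + k) %% m :> nat.
Proof.
elim: k => [|k IHk] /=; first by rewrite addn0 modn_small.
by rewrite IHk -addn1 modnDml addn1 addnS.
Qed.

Lemma segment_lengthP (i : 'I_m) : i \in segments ->
  [/\ 0 < segment_length i,
      tnth S (iter (segment_length i) (@ordS m) i) = false
    & forall j, 0 < j < segment_length i -> tnth S (iter j (@ordS m) i)].
Proof.
rewrite inE => si; set a := fun k => ~~ tnth S (iter k.+1 (@ordS m) i).
have ha : has a (iota 0 m).
  have m_gt0 : 0 < m by apply: leq_ltn_trans (ltn_ord i).
  apply/hasP; exists m.-1; first by rewrite mem_iota /= add0n prednK.
  rewrite /a prednK //; suff -> : iter m (@ordS m) i = i by [].
  by apply: val_inj; rewrite /= val_iter_ordS modnDr modn_small.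
have lt_m : find a (iota 0 m) < m by rewrite -[X in _ < X](size_iota 0 m) -has_find.
split=> //.
  by have := nth_find 0 ha; rewrite nth_iota // add0n => /negbTE.
case=> // j /andP[_]; rewrite /segment_length ltnS => lt_j.
have := before_find 0 lt_j.
by rewrite nth_iota ?(ltn_trans lt_j) // add0n => /negbFE.
Qed.

End QuasiWreath.

(* Main.v *)
Require Import Defs.
From mathcomp Require Import all_boot all_order all_algebra.
From mathcomp Require Import zify ring.

(** Write [p i] and [q i] for the sum and the difference of the labels of [x_i]
    and [y_i].  Adding and subtracting the weights of [x_i] and [y_i] separates
    the magic condition ([zero_weightsP]) into a linear system in [p] alone
    ([balanced]) and the equations [q i = q (i + 1)] whenever [s_i = 0].  The
    system for [p] is a transfer problem ([balancedP]): inside a segment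
    [p (k + 2) = - p k], so [p] runs through A, B, -A, -B, A, B and so on, and
    where two segments meet, the first two values (A', B') of the next one are
    a linear function of (A, B) that depends only on the length modulo 4
    ([segment_transfer]).

    Necessity.  The quantity [- B * (A + B)] grows from a segment to the next
    one by [2 B^2] if the length is odd and by [(A + B)^2] if it is even
    ([drift_step]).  Passing to the next segment permutes the segments, so the
    increments add up to 0 and each of them is 0.  On both sides of a place
    where [s_i = 0] the differences [q] agree, so the sums [p] must not agree,
    which says [A + B <> 0].  Hence all lengths are odd and all B are 0.  Then
    A' = -A for length 1 modulo 4 and A' = A for length 3, and comparing the
    product of all A with itself, reindexed by the next segment, shows that the
    sign occurs an even number of times.

    Sufficiency.  Under the parity conditions the system for [p] has a solution
    with values in {0, 1, -1} that is 0 exactly on the blocks of even position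
    in their segment ([sign]).  Scaled by 4 h, where h is the number of blocks
    of sign 1, it serves as [p].  Since the solutions of the system have sum 0
    ([balanced_sum]), there are also h blocks of sign -1, so [q / 2] can be
    chosen to take the values 1, 3, ..., 2 h - 1 once on each of these two
    classes, with equal values on the two blocks that meet at each [s_i = 0]
    ([half_difference]).  The blocks of sign 1 and -1 then use the labels of
    absolute value below 4 h, each once, and each block of sign 0 receives a
    pair of opposite labels from the remaining ones. *)

Set Implicit Arguments.
Unset Strict Implicit.
Unset Printing Implicit Defensive.

Import Order.TTheory GRing.Theory Num.Theory.

(** * Finite combinatorics *)

Section Preliminaries.

Local Open Scope ring_scope.

Lemma set2_eq (T : finType) (a b c d : T) :
  ([set a; b] == [set c; d]) = ((a == c) && (b == d)) || ((a == d) && (b == c)).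
Proof.
apply/eqP/idP => [E|]; last first.
  by case/orP => /andP[/eqP-> /eqP->] //; rewrite setUC.
have := set21 a b; have := set22 a b; rewrite E !inE.
have := set21 c d; have := set22 c d; rewrite -E !inE.
by rewrite ![c == _]eq_sym ![d == _]eq_sym; case: (a == c); case: (a == d);
  case: (b == c); case: (b == d).
Qed.

Lemma sum_eq2 (I : finType) (f : I -> int) a b : a != b ->
  \sum_(i | (i == a) || (i == b)) f i = f a + f b.
Proof.
move=> ab; rewrite (bigD1 a) ?eqxx //= (bigD1 b) ?eqxx ?orbT /= 1?eq_sym //.
by rewrite big1 ?addr0 // => i; case: (i == a); case: (i == b).
Qed.

(** A sequence with [u (j + 2) = - u j] has period 4 up to its first two
    entries, so its last two entries depend only on its length modulo 4. *)
Lemma run_end (u : nat -> int) n :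
  (forall j, (0 < j)%N -> (j.+1 < n)%N -> u j.+2 = - u j) ->
  (1 < n)%N ->
  (u n.-1, u n) = match (n %% 4)%N with
    | 0%N => (- u 1%N, - u 2%N)
    | 1%N => (- u 2%N, u 1%N)
    | 2%N => (u 1%N, u 2%N)
    | _ => (u 2%N, - u 1%N)
    end.
Proof.
move=> run; case: n run => // n run n_gt0.
suff H k : (0 < k <= n)%N -> (u k, u k.+1) = match (k.+1 %% 4)%N with
    | 0%N => (- u 1%N, - u 2%N)
    | 1%N => (- u 2%N, u 1%N)
    | 2%N => (u 1%N, u 2%N)
    | _ => (u 2%N, - u 1%N)
    end by apply: H; lia.
elim: k => // k IHk /andP[_ k_lt]; case: k IHk k_lt => [//|k IHk k_lt].
have := IHk (ltnW k_lt); have -> := run k.+1 isT k_lt.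
case E: (k.+2 %% 4)%N => [|[|[|[|r]]]].
- have -> : (k.+3 %% 4 = 1)%N by lia.
  by case=> -> ->; rewrite opprK.
- have -> : (k.+3 %% 4 = 2)%N by lia.
  by case=> -> ->; rewrite opprK.
- have -> : (k.+3 %% 4 = 3)%N by lia.
  by case=> -> ->.
- have -> : (k.+3 %% 4 = 0)%N by lia.
  by case=> -> ->.
- by lia.
Qed.

(** A ranking of [P] may be prescribed along any injective family in [P]: list
    the family first and the rest of [P] afterwards.  Two sets of equal size
    ranked along two families with the same index set are thereby matched in a
    way that extends the given partial matching. *)
Lemma rank_extending (T I : finType) (D : {set I}) (f : I -> T) (P : {set T}) :
  {in D &, injective f} -> (forall i, i \in D -> f i \in P) ->
  exists t : T -> nat, [/\ {in P &, injective t}, forall x, x \in P -> (t x < #|P|)%N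
     & forall i, i \in D -> t (f i) = index i (enum D)].
Proof.
move=> f_inj fP.
pose s := map f (enum D) ++ enum (P :\: [set f i | i in D]).
have sP x : (x \in s) = (x \in P).
  rewrite mem_cat mem_enum inE; case: mapP => [[i]|noti] /=.
    by rewrite mem_enum => Di ->; rewrite fP.
  suff -> : x \notin [set f i | i in D] by [].
  by apply/imsetP => -[i Di xE]; apply: noti; exists i; rewrite ?mem_enum.
have s_uniq : uniq s.
  rewrite cat_uniq enum_uniq andbT map_inj_in_uniq ?enum_uniq.
    apply/hasPn => x; rewrite mem_enum inE => /andP[notf _]; apply/mapP => -[i].
    by rewrite mem_enum => Di xE; rewrite xE imset_f in notf.
  by move=> i j; rewrite !mem_enum; apply: f_inj.
exists (index^~ s); split=> [x y xP yP|x xP|i Di].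
- by apply: index_inj; rewrite ?sP.
- have -> : #|P| = size s by rewrite -(card_uniqP s_uniq); apply: eq_card.
  by rewrite index_mem sP.
- have D_i : i \in enum D by rewrite mem_enum.
  rewrite index_cat map_f // -{1}(nth_index i D_i) -(nth_map _ (f i)) ?index_mem //.
  rewrite index_uniq ?size_map ?index_mem // map_inj_in_uniq ?enum_uniq //.
  by move=> j k; rewrite !mem_enum; apply: f_inj.
Qed.

End Preliminaries.

Section QuasiWreathWeights.

Local Open Scope ring_scope.

Variables (m : nat) (S : m.-tuple bool).
Hypothesis sparse : forall i, tnth S i || tnth S (ordS i).

(** * Adjacency and the equations for the weights *)

Section Weights.

Hypothesis m_gt2 : (2 < m)%N.

Lemma ordS_neq (i : 'I_m) : ordS i != i.
Proof.
rewrite -val_eqE /=; have := ltn_ord i.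
case: (ltnP i.+1 m) => [lt _|le lt]; first by rewrite modn_small //; lia.
by rewrite -(subnK le) modnDr modn_small; lia.
Qed.

Lemma ord_pred_neq (i : 'I_m) : ord_pred i != i.
Proof. by rewrite -{2}(ord_predK i) eq_sym ordS_neq. Qed.

Lemma ordS2_neq (i : 'I_m) : ordS (ordS i) != i.
Proof.
rewrite -val_eqE /= -addn1 modnDml addn1.
have := ltn_ord i; case: (ltnP i.+2 m) => [lt _|le lt].
  by rewrite modn_small //; lia.
by rewrite -(subnK le) modnDr modn_small; lia.
Qed.

Lemma ordS_neq_pred (i : 'I_m) : ordS i != ord_pred i.
Proof. by rewrite -{1}(ord_predK i) ordS2_neq. Qed.

(** Naming the side by a boolean lets [~~ b] denote the opposite side, so that
    the two halves of the graph are handled by one statement. *)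
Definition vtx (b : bool) (i : 'I_m) : qw_vertex m := if b then inl i else inr i.

Lemma vtx_eq b c i j : (vtx b i == vtx c j) = (b == c) && (i == j).
Proof. by case: b; case: c. Qed.

(** Each of the two edge sets attached to the indices i and i - 1 gives the
    vertex [vtx b i] one neighbour on the opposite side; [cross_next i] and
    [cross_prev i] are the blocks of these neighbours. *)
Definition cross_next (i : 'I_m) : 'I_m := if tnth S i then ordS i else i.

Definition cross_prev (i : 'I_m) : 'I_m :=
  if tnth S (ord_pred i) then ord_pred i else i.

(** This is where the absence of two cyclically consecutive zeros enters: with
    [s_(i-1) = s_i = 0] the rung at i would be counted twice. *)
Lemma cross_neq i : cross_next i != cross_prev i.
Proof.
rewrite /cross_next /cross_prev; have := sparse (ord_pred i).
rewrite ord_predK; case: (tnth S i) (tnth S (ord_pred i)) => [] [] //= _.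
- exact: ordS_neq_pred.
- exact: ordS_neq.
- by rewrite eq_sym ord_pred_neq.
Qed.

Lemma QW_vtx b c i j : QW S (vtx b i) (vtx c j) =
  if b == c then (j == ordS i) || (j == ord_pred i)
  else (j == cross_next i) || (j == cross_prev i).
Proof.
have qxE k : qx k = vtx true k by [].
have qyE k : qy k = vtx false k by [].
apply/bigcupP/idP => [[k _]|].
  rewrite !qxE !qyE /cross_next /cross_prev.
  by case Sk: (tnth S k); rewrite !inE !set2_eq !vtx_eq => H; case: b H; case: c => /= H;
    repeat (case/orP: H => H || move: H => /andP[/eqP E1 /eqP E2] || discriminate H);
    subst; rewrite ?ordSK ?Sk ?eqxx ?orbT.
rewrite /cross_next /cross_prev.
have next_of k : k = ordS (ord_pred k) by rewrite ord_predK.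
case: ifP => [/eqP <- | bc] /orP[] /eqP ->.
- by exists i => //; rewrite !qxE !qyE; case: b; case: ifP => _;
    rewrite !inE !set2_eq !vtx_eq !eqxx ?orbT.
- by exists (ord_pred i) => //; rewrite -next_of !qxE !qyE; case: b; case: ifP => _;
    rewrite !inE !set2_eq !vtx_eq !eqxx ?orbT.
- by exists i => //; rewrite !qxE !qyE; case: b bc; case: c => // _; case: ifP => _;
    rewrite !inE !set2_eq !vtx_eq !eqxx ?orbT.
- by exists (ord_pred i) => //; rewrite -next_of !qxE !qyE; case: b bc; case: c => // _;
    case: ifP => _; rewrite !inE !set2_eq !vtx_eq !eqxx ?orbT.
Qed.

Lemma weight_vtx l b i : weight (QW S) l (vtx b i) =
  l (vtx b (ordS i)) + l (vtx b (ord_pred i)) +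
  (l (vtx (~~ b) (cross_next i)) + l (vtx (~~ b) (cross_prev i))).
Proof.
rewrite /weight big_sumType /=.
rewrite (eq_bigl _ _ (fun j => QW_vtx b true i j)).
rewrite (eq_bigl _ _ (fun j => QW_vtx b false i j)).
by case: b => /=; rewrite !sum_eq2 ?ordS_neq_pred ?cross_neq // addrC.
Qed.

(** The equation that the block sums of a labeling satisfy when the weights of
    the two vertices of each block add up to 0. *)
Definition balanced (p : 'I_m -> int) :=
  forall i, p (ordS i) + p (ord_pred i) + (p (cross_next i) + p (cross_prev i)) = 0.

Lemma zero_weightsP (l : qw_vertex m -> int) :
  (forall v, weight (QW S) l v = 0) <->
  balanced (fun i => l (inl i) + l (inr i)) /\
  (forall i, ~~ tnth S i ->
     l (inl i) - l (inr i) = l (inl (ordS i)) - l (inr (ordS i))).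
Proof.
have wx := weight_vtx l true; have wy := weight_vtx l false; rewrite /= in wx wy.
split=> [w0|[bal dif]].
  split=> i; first by have := w0 (inl i); have := w0 (inr i); rewrite wx wy /=; lia.
  move=> Si; have := w0 (inl i); have := w0 (inr i); rewrite wx wy.
  have := sparse (ord_pred i); rewrite /cross_next /cross_prev ord_predK (negbTE Si).
  by case: (tnth S (ord_pred i)) => //= _; clear; lia.
have w i : weight (QW S) l (inl i) = 0 /\ weight (QW S) l (inr i) = 0.
  rewrite wx wy; have := bal i; have := dif i; have := dif (ord_pred i).
  have := sparse (ord_pred i); rewrite /cross_next /cross_prev ord_predK.
  case: (tnth S i) => /=; case: (tnth S (ord_pred i)) => //= _.
  - by lia.
  - by move=> /(_ isT); lia.
  - by move=> _ /(_ isT); lia.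
by case=> i; case: (w i).
Qed.

(** Two blocks are told apart by the sum and the difference of their labels. *)
Lemma sum_neq_of_difference_eq (l : qw_vertex m -> int) i : injective l ->
  l (inl i) - l (inr i) = l (inl (ordS i)) - l (inr (ordS i)) ->
  l (inl i) + l (inr i) != l (inl (ordS i)) + l (inr (ordS i)).
Proof.
move=> l_inj diff_eq; apply/eqP => sum_eq.
have /l_inj[E] : l (inl i) = l (inl (ordS i)) by lia.
by have := ordS_neq i; rewrite -E eqxx.
Qed.

End Weights.

(** The local form of [balanced]: the equation at a block reads differently
    according to whether the block is interior to its segment, first or last. *)
Lemma balancedP (p : 'I_m -> int) : balanced p <->
  forall i,
    if tnth S i then tnth S (ordS i) -> p (ordS (ordS i)) = - p i
    else p i + p (ordS i) + p (ordS (ordS i)) *+ 2 = 0 /\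
         p (ord_pred i) *+ 2 + p i + p (ordS i) = 0.
Proof.
split=> [bal i|H i].
  have := bal i; have := bal (ordS i).
  rewrite /cross_next /cross_prev ordSK.
  have := sparse i; have := sparse (ord_pred i); rewrite ord_predK.
  case: (tnth S i) => /=; case: (tnth S (ordS i)) => //=.
    by move=> _ _ E _ _; lia.
  by case: (tnth S (ord_pred i)) => // _ _; lia.
have := H i; have := H (ord_pred i).
rewrite /cross_next /cross_prev ord_predK; have := sparse (ord_pred i); rewrite ord_predK.
case: (tnth S i) => /=; case: (tnth S (ord_pred i)) => //= _.
- by move=> /(_ isT) -> _; lia.
- by lia.
- by lia.
Qed.

(** Adding up all the equations counts every entry four times. *)
Lemma balanced_sum p : balanced p -> \sum_i p i = 0.
Proof.
move=> bal; have shift (F : 'I_m -> int) : \sum_i F (ordS i) = \sum_i F i.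
  by rewrite [RHS](reindex_inj (@ordS_inj m)).
have : \sum_i (p (ordS i) + p (ord_pred i) + (p (cross_next i) + p (cross_prev i))) = 0.
  by apply: big1 => i _; apply: bal.
have pred_sum : \sum_i p (ord_pred i) = \sum_i p i.
  by rewrite -[LHS]shift; apply: eq_bigr => i _; rewrite ordSK.
have cross_sum : \sum_i (p (cross_next i) + p (cross_prev i)) = \sum_i p i + \sum_i p i.
  rewrite -[X in _ + X](shift p) big_split /= -(shift (fun i => p (cross_prev i))).
  rewrite -!big_split; apply: eq_bigr => i _; rewrite /cross_next /cross_prev ordSK /=.
  by case: (tnth S i); rewrite // addrC.
rewrite big_split /= cross_sum big_split /= pred_sum shift.
by move: (\sum_i p i) => s; clear; lia.
Qed.

(** * The cyclic order of the segments *)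

Definition next_segment (i : 'I_m) : 'I_m := iter (segment_length S i) (@ordS m) i.

Lemma segment_length_gt1 i : i \in segments S -> (1 < segment_length S i)%N.
Proof.
move=> seg_i; case: (segment_lengthP seg_i); have := sparse i; rewrite inE in seg_i.
rewrite (negbTE seg_i) orFb.
by case: (segment_length S i) => [|[|n]] //= -> _ /eqP.
Qed.

Lemma next_segment_in i : i \in segments S -> next_segment i \in segments S.
Proof. by move=> /segment_lengthP[_ Sn _]; rewrite inE Sn. Qed.

(** If two segments had the same successor, the start of the shorter one would
    lie strictly inside the longer one. *)
Lemma next_segment_inj : {in segments S &, injective next_segment}.
Proof.
move=> i j.
wlog le_ij : i j / (segment_length S i <= segment_length S j)%N.
  move=> H; case/orP: (leq_total (segment_length S i) (segment_length S j)).
    exact: H.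
  by move=> le Hi Hj E; apply/esym/H.
move=> Hi Hj; rewrite /next_segment -(subnKC le_ij) iterD.
have inj n : injective (iter n (@ordS m)).
  by elim: n => // n IHn x y /ordS_inj/IHn.
move/inj; case: (posnP (segment_length S j - segment_length S i)) => [-> //|pos] E.
case: (segment_lengthP Hj) => _ _ /(_ (segment_length S j - segment_length S i)%N).
have := segment_length_gt1 Hi; move: (Hi); rewrite inE -E => /negbTE -> ?.
by move/(_ ltac:(lia)).
Qed.

Lemma reindex_next_segment (R : Type) (idx : R) (op : Monoid.com_law idx)
    (F : 'I_m -> R) :
  \big[op/idx]_(i in segments S) F (next_segment i) =
  \big[op/idx]_(i in segments S) F i.
Proof.
rewrite -(big_imset F next_segment_inj); apply: eq_bigl => i.
suff -> : [set next_segment x | x in segments S] = segments S by [].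
apply/eqP; rewrite eqEcard card_in_imset ?leqnn ?andbT; last exact: next_segment_inj.
by apply/subsetP => _ /imsetP[j Hj ->]; apply: next_segment_in.
Qed.

Lemma balanced_run p i j : balanced p -> i \in segments S ->
  (0 < j)%N -> (j.+1 < segment_length S i)%N ->
  p (iter j.+2 (@ordS m) i) = - p (iter j (@ordS m) i).
Proof.
move=> /balancedP bal seg_i j_gt0 j_lt; have [_ _ Strue] := segment_lengthP seg_i.
have := bal (iter j (@ordS m) i); rewrite (Strue j) ?j_gt0 /=; last by lia.
by apply; apply: (Strue j.+1); lia.
Qed.

(** * Necessity *)

Section Necessity.

Variable p : 'I_m -> int.
Hypothesis bal_p : balanced p.
Hypothesis link_neq : forall i, i \in segments S -> p i != p (ordS i).

Definition first_sum i := p (ordS i).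

Definition second_sum i := p (ordS (ordS i)).

Lemma segment_transfer i : i \in segments S ->
  (first_sum (next_segment i), second_sum (next_segment i)) =
  match (segment_length S i %% 4)%N with
    | 0%N => (first_sum i *+ 2 + second_sum i, - first_sum i)
    | 1%N => (- first_sum i + second_sum i *+ 2, - second_sum i)
    | 2%N => (- first_sum i *+ 2 - second_sum i, first_sum i)
    | _ => (first_sum i - second_sum i *+ 2, second_sum i)
    end.
Proof.
move=> seg_i; have n_gt1 := segment_length_gt1 seg_i.
have := run_end (fun j => @balanced_run p i j bal_p seg_i) n_gt1.
have := next_segment_in seg_i; rewrite inE => next_i.
have /balancedP/(_ (next_segment i)) := bal_p; rewrite (negbTE next_i).
have -> : ord_pred (next_segment i) = iter (segment_length S i).-1 (@ordS m) i.
  by rewrite /next_segment -{1}(ltn_predK n_gt1) ordSK.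
rewrite -/(next_segment i) -/(first_sum (next_segment i)) -/(second_sum (next_segment i)).
case: (_ %% 4)%N => [|[|[|r]]] [E1 E2] [E3 E4]; rewrite E3 E4 /= in E1 E2;
  by rewrite -/(first_sum i) -/(second_sum i) in E1 E2; congr pair; lia.
Qed.

(** In the coordinates [first_sum + second_sum] and [- second_sum] the maps of
    [segment_transfer] are, up to sign, the shears (a, b) -> (a + 2 b, b) and
    (a, b) -> (a, a + b); the product of the two coordinates is insensitive to
    the sign and cannot decrease under either shear. *)
Definition drift i : int := - second_sum i * (first_sum i + second_sum i).

Lemma drift_step i : i \in segments S ->
  drift (next_segment i) - drift i =
    if odd (segment_length S i) then second_sum i ^+ 2 *+ 2
    else (first_sum i + second_sum i) ^+ 2.
Proof.
move=> seg_i; have := segment_transfer seg_i; rewrite /drift.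
have -> : odd (segment_length S i) = odd (segment_length S i %% 4) by lia.
by case: (_ %% 4)%N (ltn_pmod (segment_length S i) (isT : 0 < 4)%N) => [|[|[|[|]]]] //= _
  [-> ->]; ring.
Qed.

(** A quantity that never decreases along a cycle is constant. *)
Lemma drift_constant i : i \in segments S -> drift (next_segment i) = drift i.
Proof.
have inc j : j \in segments S -> 0 <= drift (next_segment j) - drift j.
  by move=> Hj; rewrite drift_step //; case: ifP => _; rewrite ?mulrn_wge0 ?sqr_ge0.
have: \sum_(j in segments S) (drift (next_segment j) - drift j) = 0.
  by rewrite sumrB reindex_next_segment subrr.
move/eqP; rewrite psumr_eq0 // => /allP H seg_i; apply/eqP.
by rewrite -subr_eq0; apply: (implyP (H i _)); rewrite ?mem_index_enum.
Qed.

(** By the equation at the first block, [p i = - first_sum i - 2 second_sum i],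
    which would be [first_sum i] if the sum vanished. *)
Lemma sum_neq0 i : i \in segments S -> first_sum i + second_sum i != 0.
Proof.
move=> seg_i; apply: contraNneq (link_neq seg_i) => E.
have := seg_i; rewrite inE => nS.
have /balancedP/(_ i) := bal_p.
rewrite (negbTE nS) -/(first_sum i) -/(second_sum i) => -[E' _].
by apply/eqP; lia.
Qed.

Lemma segment_odd i : i \in segments S -> odd (segment_length S i) /\ second_sum i = 0.
Proof.
move=> seg_i; have := drift_step seg_i; rewrite drift_constant // subrr.
case: ifP => _ /esym/eqP; rewrite ?mulrn_eq0 sqrf_eq0 /=; first by move/eqP.
by rewrite (negbTE (sum_neq0 seg_i)).
Qed.

(** With all [second_sum] equal to 0, going around the cycle multiplies
    [first_sum] by -1 once for each segment of length 1 modulo 4, and must restore it. *)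
Lemma even_number_of_1mod4 :
  ~~ odd #|[set i in segments S | segment_length S i == 1 %[mod 4]]|.
Proof.
have first_neq0 i : i \in segments S -> first_sum i != 0.
  by move=> seg_i; have := sum_neq0 seg_i; have [_ ->] := segment_odd seg_i;
    rewrite addr0.
have prod0 : \prod_(i in segments S) first_sum i != 0 by apply/prodf_neq0.
have step i : i \in segments S ->
    first_sum (next_segment i) = (-1) ^+ (segment_length S i == 1 %[mod 4]) * first_sum i.
  move=> seg_i; have [odd_n second0] := segment_odd seg_i.
  have := segment_transfer seg_i.
  rewrite second0; have : odd (segment_length S i %% 4) by lia.
  by case: (_ %% 4)%N (ltn_pmod (segment_length S i) (isT : 0 < 4)%N)
    => [|[|[|[|]]]] //= _ _ [-> _]; ring.
have := reindex_next_segment (@GRing.mul int) first_sum.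
rewrite (eq_bigr _ step) big_split /= -[RHS]mul1r => /(mulIf prod0).
rewrite prodrXr -sum1dep_card big_mkcondr /=.
rewrite -signr_odd.
rewrite (eq_bigr (fun i => if segment_length S i == 1 %[mod 4] then 1%N else 0%N)).
  by case: (odd _).
by move=> i _; case: ifP.
Qed.

End Necessity.

(** * A balanced assignment of signs to the blocks *)

Section SignPattern.

Hypothesis odd_lengths : forall i, i \in segments S -> odd (segment_length S i).
Hypothesis first_segment : nth false S 0 = false.

(** The m-periodic extension of S: the recursion below runs over all natural
    numbers. *)
Definition cyc (k : nat) : bool := nth false S (k %% m).

Lemma cyc_iter (i : 'I_m) j : cyc (i + j) = tnth S (iter j (@ordS m) i).
Proof. by rewrite (tnth_nth false) val_iter_ordS. Qed.

Lemma cyc_ord (i : 'I_m) : cyc i = tnth S i.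
Proof. by rewrite -[i in cyc i]addn0 cyc_iter. Qed.

Lemma cyc0 : cyc 0 = false.
Proof. by rewrite /cyc mod0n. Qed.

Lemma cyc_period k : cyc (k + m) = cyc k.
Proof. by rewrite /cyc modnDr. Qed.

Lemma cycm : cyc m = false.
Proof. by rewrite -[X in cyc X]add0n cyc_period cyc0. Qed.

(** The pair of the signs at k and k + 1.  The recursion solves [balancedP] from
    left to right with value 0 at the second block of each segment; it is
    defined on all natural numbers, and that it closes up around the cycle is
    [sign_period]. *)
Fixpoint sign_pair (k : nat) : int * int :=
  if k is j.+1 then
    let ab := sign_pair j in
    (ab.2, if cyc k then (if cyc j then - ab.1 else 0) else - ab.2)
  else (1, -1).

Definition sign (k : nat) : int := (sign_pair k).1.

Lemma signSS k : sign k.+2 =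
  if cyc k.+1 then (if cyc k then - sign k else 0) else - sign k.+1.
Proof. by []. Qed.

Lemma sign_link k : cyc k = false -> sign k.+1 = - sign k.
Proof. by case: k => // k H; rewrite signSS H. Qed.

Lemma sign_values k : sign k \in [:: 0; 1; -1].
Proof.
suff: (sign k \in [:: 0; 1; -1]) && (sign k.+1 \in [:: 0; 1; -1]) by case/andP.
elim: k => // k /andP[IH1 IH2]; rewrite IH2 signSS /=.
have oppP x : x \in [:: 0; 1; -1] -> - x \in [:: 0; 1; -1 : int].
  by rewrite !inE => /or3P[] /eqP->.
by case: (cyc k.+1); case: (cyc k); rewrite ?oppP.
Qed.

(** The value that [sign] must have at a segment end k: each segment of length 1
    modulo 4 passed since 0 turns the sign over. *)
Definition turns (k : nat) : int :=
  \prod_(i in segments S | (i < k)%N && (segment_length S i == 1 %[mod 4])) (-1).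

Lemma turns_neq0 k : turns k != 0.
Proof. by apply/prodf_neq0. Qed.

Lemma turns0 : turns 0 = 1.
Proof. by rewrite /turns big1 // => i /andP[_]; rewrite ltn0. Qed.

Lemma cyc_segment i j : i \in segments S -> (0 < j < segment_length S i)%N -> cyc (i + j).
Proof. by move=> /segment_lengthP[_ _ H] Hj; rewrite cyc_iter; apply: H. Qed.

Lemma cyc_segment_end i : i \in segments S -> cyc (i + segment_length S i) = false.
Proof. by move=> /segment_lengthP[_ H _]; rewrite cyc_iter. Qed.

Lemma turns_step i : i \in segments S ->
  turns (i + segment_length S i) = (-1) ^+ (segment_length S i == 1 %[mod 4]) * turns i.
Proof.
move=> seg_i; rewrite /turns; have n_gt0 := ltnW (segment_length_gt1 seg_i).
have other (j : 'I_m) : j \in segments S -> j != i ->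
    (j < i + segment_length S i)%N = (j < i)%N.
  move=> seg_j ji; apply/idP/idP => [lt|]; last by lia.
  rewrite ltn_neqAle ji leqNgt; apply/negP => lt2; move: seg_j.
  by rewrite inE -cyc_ord -(subnKC (ltnW lt2)) cyc_segment //; lia.
case E: (segment_length S i == 1 %[mod 4]).
  rewrite (bigD1 i) /= ?seg_i ?E ?andbT; last by lia.
  congr (_ * _); apply: eq_bigl => j; case seg_j: (j \in segments S) => //=.
  have [->|ji] := eqVneq j i; first by rewrite ltnn andbF.
  by rewrite other // andbT.
rewrite mul1r; apply: eq_bigl => j; case seg_j: (j \in segments S) => //=.
by have [->|ji] := eqVneq j i; rewrite ?E ?andbF ?other.
Qed.

Lemma sign_segment i : i \in segments S ->
  sign (i + segment_length S i).-1 = 0 /\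
  sign (i + segment_length S i) = (-1) ^+ (segment_length S i == 1 %[mod 4]) * sign i.
Proof.
move=> seg_i; have n_gt1 := segment_length_gt1 seg_i.
have cyc_i : cyc i = false by move: seg_i; rewrite cyc_ord inE => /negbTE.
have run j : (0 < j)%N -> (j.+1 < segment_length S i)%N ->
    sign (i + j.+2) = - sign (i + j).
  by move=> j0 jn; rewrite !addnS signSS -addnS !cyc_segment //; lia.
have sign1 : sign (i + 1) = - sign i by rewrite addn1 sign_link.
have sign2 : sign (i + 2) = 0 by rewrite addn2 signSS cyc_i -addn1 cyc_segment.
have := run_end run n_gt1; rewrite sign1 sign2.
have -> : (i + (segment_length S i).-1 = (i + segment_length S i).-1)%N by lia.
have := odd_lengths seg_i.
have -> : odd (segment_length S i) = odd (segment_length S i %% 4) by lia.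
rewrite (_ : (1 %% 4 = 1)%N) //.
case: (_ %% 4)%N (ltn_pmod (segment_length S i) (isT : 0 < 4)%N) => [|[|[|[|]]]] //= _ _.
  by case=> -> ->; rewrite oppr0 mulN1r.
by case=> -> ->; rewrite opprK mul1r.
Qed.

(** Walks from each segment to the next one, starting at 0.  The second part,
    the remaining condition of [balancedP], holds because the last but one
    block of a segment of odd length has even position. *)
Lemma sign_at_links k : (k <= m)%N -> cyc k = false ->
  sign k = turns k /\ ((0 < k)%N -> sign k.-1 = 0).
Proof.
(* The induction is on the distance d that remains up to m. *)
suff walk d j : (m - j <= d)%N -> cyc j = false -> sign j = turns j ->
    forall k, (j <= k <= m)%N -> cyc k = false ->
    sign k = turns k /\ ((j < k)%N -> sign k.-1 = 0).
  move=> k_le; apply: (@walk m 0) => //; rewrite ?cyc0 ?turns0 ?subn0 //.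
elim: d j => [|d IHd] j d_ge cyc_j sign_j {}k /andP[jk km] cyc_k.
  have -> : k = j by lia.
  by rewrite ltnn.
have [->|neq] := eqVneq k j; first by rewrite ltnn.
have jm : (j < m)%N by lia.
have [i jE] : exists i : 'I_m, j = i by exists (Ordinal jm).
rewrite {}jE in d_ge cyc_j sign_j jk neq jm *.
have seg_i : i \in segments S by rewrite inE -cyc_ord cyc_j.
have n_gt1 := segment_length_gt1 seg_i.
have [sign0 signE] := sign_segment seg_i.
have le_k : (i + segment_length S i <= k)%N.
  rewrite leqNgt; apply/negP => lt; have := @cyc_segment i (k - i) seg_i.
  by rewrite subnKC // cyc_k /= => /(_ ltac:(lia)).
have [||||-> ktl] := IHd (i + segment_length S i)%N _ _ _ k _ cyc_k.
- by rewrite /=; lia.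
- exact: cyc_segment_end.
- by rewrite signE turns_step // sign_j.
- by rewrite le_k km.
split=> // _; have [->//|neq2] := eqVneq k (i + segment_length S i)%N.
by apply: ktl; lia.
Qed.

Hypothesis even_1mod4 :
  ~~ odd #|[set i in segments S | segment_length S i == 1 %[mod 4]]|.

Lemma turnsm : turns m = 1.
Proof.
rewrite /turns (eq_bigl (mem [set i in segments S | segment_length S i == 1 %[mod 4]])).
  by rewrite prodr_const -signr_odd (negbTE even_1mod4).
by move=> i; rewrite !inE ltn_ord.
Qed.

Lemma sign_period k : sign (k + m) = sign k.
Proof.
suff : sign_pair (k + m) = sign_pair k by rewrite /sign => ->.
elim: k => [|k IHk]; last by rewrite addSn /= IHk -addSn !cyc_period.
have [signm _] := sign_at_links (leqnn m) cycm.
rewrite [LHS]surjective_pairing add0n -/(sign m) -[_.2]/(sign m.+1).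
by rewrite (sign_link cycm) signm turnsm.
Qed.

Lemma sign_iter (i : 'I_m) j : sign (iter j (@ordS m) i) = sign (i + j).
Proof.
rewrite val_iter_ordS [in RHS](divn_eq (i + j) m).
by elim: (_ %/ m)%N => [//|q ->]; rewrite mulSn -addnA (addnC m) sign_period.
Qed.

Lemma balanced_sign : balanced (fun i => sign i).
Proof.
apply/balancedP => i.
rewrite -[ordS (ordS i)]/(iter 2 (@ordS m) i) -[ordS i]/(iter 1 (@ordS m) i).
rewrite !sign_iter -cyc_iter -cyc_ord addn1 addn2 signSS.
case cyc_i: (cyc i); first by move=> ->.
have -> : cyc i.+1.
  by have := sparse i; rewrite -cyc_ord cyc_i -addn1 cyc_iter.
rewrite sign_link //; split; first by rewrite subrr mul0rn.
have cyc_pred : cyc (ord_pred i).+1 = false.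
  by rewrite -addn1 cyc_iter -[iter 1 _ _]/(ordS _) ord_predK -cyc_ord.
by rewrite addrK; have [_ ->] := sign_at_links (ltn_ord (ord_pred i)) cyc_pred.
Qed.

End SignPattern.

(** * From signs to a distance magic labeling *)

Section Labeling.

Variable e : 'I_m -> int.
Hypothesis e_values : forall i, e i \in [:: 0; 1; -1].
Hypothesis bal_e : balanced e.
Hypothesis e_link : forall i, i \in segments S -> e i != 0 /\ e (ordS i) = - e i.

Definition sign_class (c : int) : {set 'I_m} := [set i | e i == c].

Definition sign_count (c : int) : nat := #|sign_class c|.

Lemma card_sign_classE c : sign_count c = (\sum_i (e i == c))%N.
Proof.
rewrite /sign_count -sum1_card big_mkcond /=; apply: eq_bigr => i _.
by rewrite inE; case: (e i == c).
Qed.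

Lemma card_sign_class : sign_count (-1) = sign_count 1.
Proof.
apply/eqP; rewrite -(eqr_nat int) !card_sign_classE !natr_sum eq_sym -subr_eq0.
rewrite -sumrB -[X in _ == X](balanced_sum bal_e).
apply/eqP; apply: eq_bigr => i _.
by have := e_values i; rewrite !inE => /or3P[] /eqP->.
Qed.

Lemma card_sign_classes : (sign_count 0 + 2 * sign_count 1 = m)%N.
Proof.
rewrite mul2n -addnn -{1}card_sign_class !card_sign_classE -!big_split /=.
rewrite -[RHS]card_ord -sum1_card; apply: eq_bigr => i _.
by have := e_values i; rewrite !inE => /or3P[] /eqP->.
Qed.

(** Half of the label difference of each block.  At every index i with
    [s_i = 0] one of the blocks i and i + 1 has sign 1 and the other sign -1;
    both classes are ranked along these indices, so that such blocks get equal
    values.  The blocks of sign 0 take the odd numbers between 4 h and 2 m. *)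
Lemma half_difference : exists d : 'I_m -> nat,
  [/\ forall i, odd (d i),
      forall i, if e i == 0 then (4 * sign_count 1 < d i < 2 * m)%N
                else (d i < 2 * sign_count 1)%N,
      forall i j, e i = e j -> d i = d j -> i = j
    & forall i, i \in segments S -> d (ordS i) = d i].
Proof.
(* The block of sign c among the two blocks that meet at i. *)
pose end_of c i := if e i == c then i else ordS i.
have end_inj c : {in segments S &, injective (end_of c)}.
  have no_adj i j : i \in segments S -> j \in segments S -> i != ordS j.
    rewrite !inE => Si Sj; apply: contraNneq Si => ->.
    by have := sparse j; rewrite (negbTE Sj).
  move=> i j Hi Hj; rewrite /end_of; case: ifP => _; case: ifP => _ //.
  - by move/eqP; rewrite (negbTE (no_adj _ _ Hi Hj)).
  - by move/esym/eqP; rewrite (negbTE (no_adj _ _ Hj Hi)).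
  - exact: ordS_inj.
have end_in c i : c \in [:: 1; -1] -> i \in segments S -> end_of c i \in sign_class c.
  move=> Hc Hi; have [] := e_link Hi; have := e_values i; rewrite /end_of.
  rewrite !inE in Hc *; case: ifP => // ne ev ne0 ->; move: ne ne0.
  by case/or3P: ev => /eqP->; case/orP: Hc => /eqP->.
have [tp [tp_inj tp_lt tp_seg]] := rank_extending (end_inj 1) (fun i => end_in 1 i isT).
have [tn [tn_inj tn_lt tn_seg]] :=
  rank_extending (end_inj (-1)) (fun i => end_in (-1) i isT).
have [||tz [tz_inj tz_lt _]] := @rank_extending _ _ set0 id (sign_class 0); first by [].
  by move=> i; rewrite inE.
have cls c i : e i = c -> i \in sign_class c by rewrite inE => ->.
have sizes := card_sign_classes.
have {}tz_lt i : e i = 0 -> (tz i < sign_count 0)%N by move/cls/tz_lt.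
have {}tp_lt i : e i = 1 -> (tp i < sign_count 1)%N by move/cls/tp_lt.
have {}tn_lt i : e i = -1 -> (tn i < sign_count 1)%N.
  by rewrite -card_sign_class; move/cls/tn_lt.
exists (fun i => if e i == 1 then (2 * tp i).+1 else if e i == -1 then (2 * tn i).+1
         else (4 * sign_count 1 + 2 * tz i).+1); split.
- by move=> i; case: ifP => _; [|case: ifP => _]; lia.
- move=> i; have := e_values i; rewrite !inE => /or3P[] /eqP ei; rewrite ei /=.
  + by have := tz_lt i ei; lia.
  + by have := tp_lt i ei; lia.
  + by have := tn_lt i ei; lia.
- move=> i j eij; have := e_values i; rewrite !inE => /or3P[] /eqP ei;
    have ci := cls _ _ ei; have := ei; rewrite eij => /cls cj; rewrite -eij ei /= => E.
  + by apply: tz_inj => //; lia.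
  + by apply: tp_inj => //; lia.
  + by apply: tn_inj => //; lia.
- move=> i Hi; have := tp_seg i Hi; have := tn_seg i Hi; have [+ ->] := e_link Hi.
  by have := e_values i; rewrite /end_of !inE => /or3P[] /eqP -> //= _ -> ->; lia.
Qed.

Hypothesis m_gt2 : (2 < m)%N.

(** Odd [d] below 2 h give labels 2 h + d and 2 h - d for sign 1, hence the odd
    numbers from 1 to 4 h - 1, and their opposites for sign -1. *)
Lemma distance_magic_of_signs : distance_magic (QW S).
Proof.
have [d [d_odd d_bound d_inj d_seg]] := half_difference.
set h := sign_count 1 in d_bound.
have h_le : (2 * h <= m)%N by rewrite -card_sign_classes leq_addl.
pose l (u : qw_vertex m) : int := match u with
  | inl i => (2 * h)%:Z * e i + (d i)%:Z
  | inr i => (2 * h)%:Z * e i - (d i)%:Z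
  end.
have card_V : #|qw_vertex m| = (2 * m)%N by rewrite card_sum card_ord; lia.
have cases i : [\/ e i = 0 /\ (4 * h < d i < 2 * m)%N,
     e i = 1 /\ (d i < 2 * h)%N | e i = -1 /\ (d i < 2 * h)%N].
  have := d_bound i; have := e_values i; rewrite !inE.
  by case/or3P => /eqP -> /= ?; [constructor 1|constructor 2|constructor 3].
have d_pos i : (0 < d i)%N by have := d_odd i; case: (d i).
have l_inj : injective l.
  move=> [i|i] [j|j] /=; have := d_pos i; have := d_pos j;
    case: (cases i) => -[ei di]; case: (cases j) => -[ej dj];
    rewrite ei ej ?mulr0 ?mulr1 ?mulrN1 => ? ? E; try (exfalso; lia);
    by rewrite (@d_inj i j) ?ei ?ej //; lia.
have l_range u : l u \in dm_labels #|qw_vertex m|.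
  rewrite card_V; apply/mapP.
  (* The k-th label is 2 k + 1 - 2 m; d is odd, so the halves below round. *)
  have : exists k, l u = (2 * k + 1)%N%:Z - (2 * m)%N%:Z /\ (k < 2 * m)%N.
    case: u => i /=; have := d_odd i; case: (cases i) => -[-> di] oi.
    all: rewrite ?mulr0 ?mulr1 ?mulrN1.
    - by exists (m + (d i)./2)%N; lia.
    - by exists (m + h + (d i)./2)%N; lia.
    - by exists (m - h + (d i)./2)%N; lia.
    - by exists (m - (d i).+1./2)%N; lia.
    - by exists (m + h - (d i).+1./2)%N; lia.
    - by exists (m - h - (d i).+1./2)%N; lia.
  by case=> k [lE k_lt]; exists k; rewrite ?mem_iota.
exists l; split=> //.
  apply: (uniq_min_size _ _ _).2.
  - by rewrite map_inj_uniq ?enum_uniq.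
  - by move=> _ /codomP[u ->].
  - by rewrite size_codom size_map size_iota.
apply (zero_weightsP m_gt2 l).2; split=> [i|i nSi] /=; last by rewrite d_seg ?inE //; lia.
have := bal_e i; rewrite /=.
have sumE j : (2 * h)%:Z * e j + (d j)%:Z + ((2 * h)%:Z * e j - (d j)%:Z) =
    (4 * h)%:Z * e j by lia.
by rewrite !sumE -!mulrDr => ->; rewrite mulr0.
Qed.

End Labeling.

End QuasiWreathWeights.

Theorem theorem1p1 (m : nat) (S : m.-tuple bool)
    (hm : 3 <= m)
    (hfirst : nth false S 0 = false)
    (hlast : nth false S (m - 1) = true)
    (hS : forall i : nat, i <= m - 2 ->
        nth false S i = true \/ nth false S i.+1 = true) :
  distance_magic (QW S) <->
    (forall i : 'I_m, i \in segments S ->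
       segment_length S i = 1 %[mod 4] \/ segment_length S i = 3 %[mod 4]) /\
    ~~ odd #|[set i in segments S | segment_length S i == 1 %[mod 4]]|.
Proof.
have sparse i : tnth S i || tnth S (ordS i).
  rewrite !(tnth_nth false) /=; have lt_i := ltn_ord i.
  case: (ltnP i.+1 m) => [lt|ge].
    by rewrite modn_small //; case: (hS i) => [|->|->]; rewrite ?orbT //; lia.
  by have -> : (i = m - 1 :> nat)%N by [lia]; rewrite hlast.
split=> [[l [l_inj _ /(zero_weightsP sparse hm)[bal dif]]]|[lengths even1]].
  have link_neq i : i \in segments S ->
      (l (inl i) + l (inr i) != l (inl (ordS i)) + l (inr (ordS i)))%R.
    by rewrite inE => nSi; apply: (sum_neq_of_difference_eq hm l_inj (dif i nSi)).
  split=> [i seg_i|]; last exact: (even_number_of_1mod4 sparse bal link_neq).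
  by have [odd_n _] := segment_odd sparse bal link_neq seg_i; lia.
have odd_lengths i : i \in segments S -> odd (segment_length S i).
  by move=> seg_i; case: (lengths i seg_i); lia.
apply: (@distance_magic_of_signs _ _ sparse (fun i => sign S i)) => [i||i seg_i|//].
- exact: sign_values.
- exact: balanced_sign.
- have cyc_i : cyc S i = false by move: seg_i; rewrite inE cyc_ord => /negbTE.
  have [sign_i _] := sign_at_links sparse odd_lengths hfirst (ltnW (ltn_ord i)) cyc_i.
  split; first by rewrite sign_i turns_neq0.
  by rewrite (sign_iter sparse odd_lengths hfirst even1 i 1) addn1 sign_link.
Qed.
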